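(* Let $S$ be a countably compact Clifford topological semigroup whose underlying topological space is regular, and let $E=\{e\in S: ee=e\}$ be its set of idempotents. Then $S$ is metrizable if and only if $E$ is a metrizable $G_\delta$-set in $S$ (that is, $E$ is metrizable in the subspace topology and $E$ is the intersection of countably many open subsets of $S$).
   Context: All topological spaces are assumed to be regular (including the $T_1$ axiom). A space is countably compact if each of its countable open covers has a finite subcover. A topological semigroup is a topological space $S$ endowed with a continuous associative operation $\cdot:S\times S\to S$. A Clifford topological semigroup is a topological semigroup $S$ that is algebraically Clifford, i.e. $S$ is the union of its subsemigroups that are groups. For each element $x$ of a Clifford semigroup there is a unique element $x^{-1}\in S$ such that $xx^{-1}x=x$, $x^{-1}xx^{-1}=x^{-1}$ and $xx^{-1}=x^{-1}x$; the inversion map $x\mapsto x^{-1}$ of a Clifford topological semigroup is not assumed to be continuous. *)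

(* Defs.v *)
From HB Require Import structures.
From mathcomp Require Import all_boot all_order all_algebra.
From mathcomp Require Import all_classical all_reals.
From mathcomp Require Import topology borel_hierarchy.

Set Implicit Arguments.
Unset Strict Implicit.
Unset Printing Implicit Defensive.

Local Open Scope classical_set_scope.
Local Open Scope group_scope.

HB.structure Definition PreTopologicalSemigroup :=
  {S of Topological S & Semigroup S}.

HB.mixin Record PreTopologicalSemigroup_isTopologicalSemigroup S
    & PreTopologicalSemigroup S := {
  mulg_continuous : continuous (fun x : S * S => x.1 * x.2) ;
}.

#[short(type="topologicalSemigroupType")]
HB.structure Definition TopologicalSemigroup :=
  {S of PreTopologicalSemigroup S
      & PreTopologicalSemigroup_isTopologicalSemigroup S}.

Section Clifford.
Variable S : semigroupType.

Definition subsemigroup (G : set S) : Prop :=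
  forall x y, G x -> G y -> G (x * y).

(* The identity e of the group G need not be an identity of S. *)
Definition group_subsemigroup (G : set S) : Prop :=
  subsemigroup G /\
  exists e, [/\ G e,
    forall x, G x -> e * x = x /\ x * e = x &
    forall x, G x -> exists y, [/\ G y, x * y = e & y * x = e]].

Definition clifford : Prop :=
  [set: S] = \bigcup_(G in group_subsemigroup) G.

Definition idempotents : set S := [set e | e * e = e].

End Clifford.

Arguments clifford : clear implicits.
Arguments idempotents : clear implicits.

(* Same shape as cover_compact, with a countable index set. *)
Definition countably_compact (T : topologicalType) (A : set T) : Prop :=
  forall (I : choiceType) (D : set I) (f : I -> set T),
    countable D -> (forall i, D i -> open (f i)) ->
    A `<=` \bigcup_(i in D) f i -> finite_subset_cover D f A.

(* m is a metric structure on the carrier of T; it comes with its own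
   topology, which is required to have the same open sets as that of T. *)
Definition metrizable (R : realType) (T : topologicalType) : Prop :=
  exists m : Metric.axioms_ R T,
    let M : metricType R := Metric.Pack m in
    forall A : set T, @open M A <-> @open T A.

(* Main.v *)
From HB Require Import structures.
Require Import Defs.
From mathcomp Require Import all_boot all_order all_algebra finmap.
From mathcomp Require Import all_classical all_reals.
From mathcomp Require Import topology borel_hierarchy urysohn.
From mathcomp Require Import lra.

(** Write x' for the inverse of x and e(x) = x x' for the unit of the
    largest group containing x.

    Suppose E is a metrizable G-delta set. As a closed subset of S it is
    countably compact, hence it shares with compact metric spaces the
    existence of arbitrarily small closed neighbourhoods
    ([metrizable_shrinkable], by way of [locally_to_globally]). Suppose
    moreover that S is first countable and that its inversion is continuous.
    Then
      x = y  <->  x y' is in E and e(x) = e(y)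
    presents the diagonal of S x S as a countable intersection of closed
    neighbourhoods, those pulled back from closed neighbourhoods of E in S
    and of the diagonal of E. In a sequentially compact space such
    neighbourhoods form a countable base of a uniformity
    ([regular_Gdelta_diagonal_metrizable]), and a Hausdorff uniformity with
    a countable base comes from a metric.

    First countability is the heart of the matter. In a regular countably
    compact space a point that is a G-delta set has a countable base
    ([Gdelta_countable_base]); this applies at once to the points of E. For
    a general x, the condition y x' = e(x) is a G-delta condition on y, but
    it is also satisfied by elements y of groups lying above that of x. They
    are excluded by requiring that powers of y come arbitrarily close to
    e(x), again a G-delta condition: if y^(m_k) tends to e(x) then e(y) =
    y^(m_k) y'^(m_k) gives e(y) = e(x) t for any accumulation point t of
    y'^(m_k), so that e(x) e(y) = e(y), while y^(m_k) e(y) = y^(m_k) gives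
    e(x) e(y) = e(x); hence e(y) = e(x). So {x} is a G-delta set as soon as
    x itself satisfies the condition, i.e. as e(x) is an accumulation point
    of the powers of x ([unit_of_power_limit]).

    The closure of the powers of x must therefore contain an idempotent, and
    this is where the countable bases at the points of E are used. If z is
    an accumulation point of the powers of x and g = e(z), then z' x^(m_k)
    tends to g for suitable m_k, so that the powers of x with exponents
    m_(k+1) - m_k accumulate at some w with g w = g
    ([absorbed_power_limit]). Iterating gives w_n with units h_n such that
    h_n w_m = h_n for n < m; at an accumulation point (h, w) of (h_n, w_n),
    where h is again idempotent, one finds h w = h and w h = w, so w is
    idempotent ([idempotent_power_limit]). An idempotent accumulation point
    of the powers of x can only be e(x).

    Once S is first countable, the inversion is continuous because its graph
    is closed and sequences accumulate.

    Conversely, a metric d on S restricts to E, and E is the intersection of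
    the open sets of all x with d(xx, x) < 1/(n+1). *)

Set Implicit Arguments.
Unset Strict Implicit.
Unset Printing Implicit Defensive.

Import Order.TTheory GRing.Theory Num.Theory.
Local Open Scope classical_set_scope.

(** * Accumulation points in countably compact spaces *)

Section Sequences.
Context {T : topologicalType}.
Implicit Types (u : nat -> T) (p : T).

Definition clusters_at u p :=
  forall (N : nat) (U : set T), nbhs p U -> exists2 n, (N <= n)%N & U (u n).

(** Accumulation of u at p is convergence along a filter finer than the one at
    infinity. Unlike a subsequence, such a filter exists without any countable
    base at p, and it preserves all the limits that other sequences already
    have: this is what allows passing to the limit in equations. *)
Lemma clusters_along u p : clusters_at u p ->
  exists F : set_system nat, [/\ ProperFilter F, F --> \oo & u @ F --> p].
Proof.
move=> up.
pose D := [set q : nat * set T | nbhs p q.2].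
pose B (q : nat * set T) := [set n | (q.1 <= n)%N /\ q.2 (u n)].
have PF : ProperFilter (filter_from D B).
  apply: filter_from_proper; last first.
    by move=> [N U] /= pU; have [n Nn Un] := up N U pU; exists n.
  apply: filter_from_filter; first by exists (0%N, setT); exact: filterT.
  move=> [N U] [M V] /= pU pV; exists (maxn N M, U `&` V); first exact: filterI.
  by move=> n [/=]; rewrite geq_max => /andP[Nn Mn] [Un Vn].
exists (filter_from D B); split=> //.
- move=> A [N _ NA]; exists (N, setT); first exact: filterT.
  by move=> n [Nn _]; exact: NA.
- by move=> A pA; exists (0%N, A) => // n [].
Qed.

Lemma along_clusters (F : set_system nat) u p :
  ProperFilter F -> F --> \oo -> u @ F --> p -> clusters_at u p.
Proof.
move=> PF Foo up N U pU.
have FN : F [set n | (N <= n)%N] by apply: Foo; exists N.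
have FU : F (u @^-1` U) := up U pU.
by have [n [Nn Un]] := filter_ex (filterI FN FU); exists n.
Qed.

Lemma clusters_sub u (phi : nat -> nat) (p : T) :
  (forall k, (k <= phi k)%N) -> clusters_at (u \o phi) p -> clusters_at u p.
Proof.
move=> phik up N U /(up N)[n Nn Un]; exists (phi n) => //.
exact: leq_trans (phik n).
Qed.

Lemma closed_clusters u : closed (clusters_at u).
Proof.
move=> p cp N U /nbhs_interior pU.
by have [q [/(_ N U) uq /uq]] := cp _ pU.
Qed.

(** Otherwise the complements of the closures of the tails of u are a
    countable open cover; a finite subcover misses a term of u with a
    large index. *)
Lemma countably_compact_clusters :
  countably_compact [set: T] -> forall u, exists p, clusters_at u p.
Proof.
move=> cc u; apply: contrapT => /forallNP nou.
pose f N := ~` closure (u @` [set n | (N <= n)%N]).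
have [|i _||D' _ cov] := cc _ [set: nat] f.
- exact: countableP.
- exact/closed_openC/closed_closure.
- move=> p _; have /existsNP[N /existsNP[U /not_implyP[pU noU]]] := nou p.
  exists N => // /(_ U pU)[_ [[n Nn <-] Un]].
  by apply: noU; exists n.
- have [i iD] := cov (u (\max_(i <- D') i)%N) I.
  apply; apply: subset_closure; exists (\max_(i <- D') i)%N => //=.
  exact: leq_bigmax_seq.
Qed.

(** The members of the base need not decrease, but are eventually inside any
    given neighbourhood: any choice of points in them is then a sequence
    converging to p. *)
Definition countable_base_at p := exists O : nat -> set T,
  (forall n, open (O n) /\ O n p) /\
  forall U, nbhs p U -> \forall n \near \oo, O n `<=` U.

Lemma countable_base_cvg p (O : nat -> set T) u :
  (forall U, nbhs p U -> \forall n \near \oo, O n `<=` U) ->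
  (forall n, O n (u n)) -> u @ \oo --> p.
Proof.
by move=> OU Ou U /OU; apply: filterS => n; apply.
Qed.

Lemma clusters_subsequence u p : countable_base_at p -> clusters_at u p ->
  exists phi : nat -> nat, (forall k, (k <= phi k)%N) /\ (u \o phi) @ \oo --> p.
Proof.
move=> [O [Op OU]] up.
have /choice[phi hphi] k : exists n, (k <= n)%N /\ O k (u n).
  have [|n kn Okn] := up k (O k); last by exists n.
  by apply: open_nbhs_nbhs; exact: Op.
exists phi; split=> [k|]; first exact: (hphi k).1.
by apply: countable_base_cvg OU _ => n; exact: (hphi n).2.
Qed.

(** Points of a regular space and its compact subsets have this property,
    which turns a G-delta set into an intersection of closed
    neighbourhoods. *)
Definition shrinkable (C : set T) := forall U, open U -> C `<=` U ->
  exists V, [/\ open V, C `<=` V & closure V `<=` U].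

(** Shrinking alternates with intersecting, so that the closure of each
    set lies in the previous set and in one more of the open sets defining
    C. *)
Lemma Gdelta_shrink (C : set T) : Gdelta C -> shrinkable C ->
  exists V : nat -> set T, [/\ forall n, open (V n), forall n, C `<=` V n,
    forall n m, (n <= m)%N -> V m `<=` V n &
    forall p, (forall n, closure (V n) p) -> C p].
Proof.
move=> [F oF CF] shC.
have /choice[sh hsh] (U : set T) : exists V, open U -> C `<=` U ->
    [/\ open V, C `<=` V & closure V `<=` U].
  have [[oU CU]|no] := pselect (open U /\ C `<=` U).
    by have [V hV] := shC U oU CU; exists V.
  by exists setT => oU CU; case: no.
pose V := fix V n := if n is n.+1 then sh (V n `&` F n) else setT.
have CFn n : C `<=` F n by rewrite CF => p; apply.
have hV n : open (V n) /\ C `<=` V n.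
  elim: n => [|n [oV CV]] /=; first by split=> //; exact: openT.
  have [||] := hsh (V n `&` F n); [exact: openI|by rewrite subsetI|].
  by [].
have cV n : closure (V n.+1) `<=` V n `&` F n.
  have [oV CV] := hV n.
  by have [||] := hsh (V n `&` F n); [exact: openI|by rewrite subsetI|].
exists V; split=> [n|n|n m|p cp]; [exact: (hV n).1|exact: (hV n).2| |].
- elim: m => [|m IH]; first by rewrite leqn0 => /eqP ->.
  rewrite leq_eqVlt => /predU1P[->//|/IH]; apply: subset_trans.
  by move=> q Vq; have [] := cV m q; first exact: subset_closure.
- by rewrite CF => n _; have [] := cV n p (cp n.+1).
Qed.

(** With V as in [Gdelta_shrink], points chosen in V n outside of some
    neighbourhood of p would accumulate in the intersection of the
    closures, i.e. at p. *)
Lemma Gdelta_countable_base p : countably_compact [set: T] ->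
  regular_space T -> Gdelta [set p] -> countable_base_at p.
Proof.
move=> cc rT Gp.
have [|V [oV pV decV clV]] := Gdelta_shrink Gp.
  move=> U oU pU.
  have /rT[W pW WU] : nbhs p U by apply: open_nbhs_nbhs; split=> //; exact: pU.
  exists W°; split; first exact: open_interior.
    by move=> _ ->.
  by apply: subset_trans WU; apply: closureS; exact: interior_subset.
exists V; split=> [n|U pU]; first by split=> //; exact: pV.
apply: contrapT => noU.
have /choice[u hu] n : exists q, V n q /\ ~ U q.
  apply: contrapT => /forallNP nq; apply: noU; exists n => // m /= nm q Vq.
  apply: contrapT => nUq; apply: (nq q); split=> //; exact: decV Vq.
have [q uq] := countably_compact_clusters cc u.
have qp : q = p.
  apply: clV => n W /(uq n)[m nm Wm].
  by exists (u m); split=> //; apply: (decV n m) => //; exact: (hu m).1.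
have [n _ Un] : exists2 n, (0 <= n)%N & U (u n) by apply: uq; rewrite qp.
by case: (hu n).
Qed.

Lemma GdeltaI (A B : set T) : Gdelta A -> Gdelta B -> Gdelta (A `&` B).
Proof.
move=> [F oF ->] [G oG ->]; exists (fun n => F n `&` G n); last first.
  by rewrite bigcapI.
by move=> n; exact: openI.
Qed.

Lemma regular_hausdorff :
  accessible_space T -> regular_space T -> hausdorff_space T.
Proof.
move=> aT rT p q pq.
apply: contrapT => /eqP /aT[A [oA /set_mem pA /set_mem nqA]].
have /rT[W pW WA] : nbhs p A by exact: open_nbhs_nbhs.
by apply/nqA/WA => V qV; exact: pq.
Qed.

End Sequences.

Lemma Gdelta_preimage (T U : topologicalType) (f : T -> U) (A : set U) :
  continuous f -> Gdelta A -> Gdelta (f @^-1` A).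
Proof.
move=> /continuousP cf [F oF ->]; exists (fun n => f @^-1` F n).
  by move=> n; exact: cf.
by rewrite preimage_bigcap.
Qed.

Lemma lim_eq (T : topologicalType) (hT : hausdorff_space T) I
    (F : set_system I) (u v : I -> T) (p q : T) : ProperFilter F ->
  u @ F --> p -> v @ F --> q -> (\forall i \near F, u i = v i) -> p = q.
Proof.
move=> FF up vq uv; suff vp : v @ F --> p by exact: (cvg_unique hT vp vq).
by apply: cvg_trans up; exact: near_eq_cvg.
Qed.

Definition sequentially_compact (T : topologicalType) := forall u : nat -> T,
  exists (phi : nat -> nat) (p : T),
    (forall k, (k <= phi k)%N) /\ (u \o phi) @ \oo --> p.

Lemma cvg_sub (T : topologicalType) (u : nat -> T) (phi : nat -> nat) (p : T) :
  (forall k, (k <= phi k)%N) -> u @ \oo --> p -> (u \o phi) @ \oo --> p.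
Proof.
move=> phik up U /up[N _ NU]; exists N => // n Nn; apply: NU.
exact: leq_trans (phik n).
Qed.

Lemma sequentially_compact_prod (T U : topologicalType) :
  sequentially_compact T -> sequentially_compact U ->
  sequentially_compact (T * U)%type.
Proof.
move=> cT cU u; have [phi [p [phik up]]] := cT (fst \o u).
have [psi [q [psik uq]]] := cU (snd \o u \o phi).
exists (phi \o psi), (p, q); split=> [k|].
  exact: leq_trans (phik _).
have -> : u \o (phi \o psi) =
    fun k => ((fst \o u \o phi \o psi) k, (snd \o u \o phi \o psi) k).
  by apply/funext => k /=; case: (u _).
by apply: cvg_pair => //; exact: cvg_sub.
Qed.

(** * Inversion and powers in Clifford semigroups *)

Section CliffordAlgebra.
Local Open Scope group_scope.

(** Inversion is a map satisfying these laws rather than an operation of the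
    semigroup; [commuting_inverse_unique] shows that there is only one. *)
Definition inversion (S : semigroupType) (inv : S -> S) := forall x,
  [/\ x * inv x * x = x, inv x * x * inv x = inv x & x * inv x = inv x * x].

Context {S : semigroupType}.
Implicit Types x y : S.

Lemma clifford_inversion : clifford S -> exists inv : S -> S, inversion inv.
Proof.
move=> cS; suff /choice[inv invP] : forall x : S, exists y,
    [/\ x * y * x = x, y * x * y = y & x * y = y * x] by exists inv.
move=> x.
have : [set: S] x by [].
rewrite cS => -[G [_ [e [Ge eG invG]]] Gx].
have [y [Gy xy yx]] := invG x Gx.
by exists y; rewrite xy yx; split=> //; [exact: (eG x Gx).1|exact: (eG y Gy).1].
Qed.

(** Both x y and x z are units for the group of x, hence x y = x z. *)
Lemma commuting_inverse_unique x y z :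
  x * y * x = x -> y * x * y = y -> x * y = y * x ->
  x * z * x = x -> z * x * z = z -> x * z = z * x -> y = z.
Proof.
move=> xyx yxy cy xzx zxz cz.
have xyz : x * y = x * z.
  have l : x * z * (x * y) = x * y by rewrite mulgA xzx.
  have r : x * z * (x * y) = x * z.
    by rewrite cy cz -mulgA (mulgA x) xyx.
  by rewrite -l r.
by rewrite -yxy -mulgA xyz mulgA -cy xyz cz zxz.
Qed.

(** This is the (n+1)-st power of x: a semigroup has no zeroth power. *)
Definition power x n := iter n ( *%g x) x.

Lemma powerD x m n : power x (m + n).+1 = power x m * power x n.
Proof. by elim: m => [|m IH] //=; rewrite -mulgA -IH. Qed.

Lemma power_commute x y n : x * y = y * x -> power x n * y = y * power x n.
Proof.
by move=> xy; elim: n => [|n IH] //=; rewrite -mulgA IH !mulgA xy.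
Qed.

Variable inv : S -> S.
Hypothesis invP : inversion inv.

Lemma invKm x : x * inv x * x = x. Proof. by have [] := invP x. Qed.
Lemma invmK x : inv x * x * inv x = inv x. Proof. by have [] := invP x. Qed.
Lemma invC x : x * inv x = inv x * x. Proof. by have [] := invP x. Qed.

Definition unit_of x := x * inv x.

Lemma unit_of_idem x : unit_of x * unit_of x = unit_of x.
Proof. by rewrite /unit_of mulgA invKm. Qed.

Lemma mul_unit_of x : x * unit_of x = x.
Proof. by rewrite /unit_of invC mulgA invKm. Qed.

Lemma power_unit_of x n : power x n * unit_of x = power x n.
Proof. by elim: n => [|n IH] /=; rewrite ?mul_unit_of // -mulgA IH. Qed.


Lemma power_inv x n : power x n * power (inv x) n = unit_of x.
Proof.
elim: n => [|n IH] //=.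
rewrite -[inv x * _]power_commute // mulgA -(mulgA x) IH.
by rewrite -[x * _]/(x * (unit_of x)) mul_unit_of.
Qed.


(** Both elements lie in the same group, where the only idempotent is the
    unit. *)
Lemma eq_of_idempotent_quotient x y :
  unit_of x = unit_of y ->
  (x * inv y) * (x * inv y) = x * inv y -> x = y.
Proof.
move=> xy ss.
have se : x * inv y * (y * inv x) = unit_of x.
  by rewrite mulgA -(mulgA x) -invC -/(unit_of y) -xy mul_unit_of.
have sx : x * inv y = unit_of x.
  rewrite -se -[in RHS]ss -[in RHS]mulgA se xy -mulgA.
  by rewrite /unit_of (mulgA (inv y)) invmK.
rewrite -(mul_unit_of x) xy /unit_of invC mulgA sx xy /unit_of.
exact: invKm.
Qed.

End CliffordAlgebra.

(** * Powers accumulate at the unit of their group *)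

Section CliffordTopology.
Local Open Scope group_scope.
Context {S : topologicalSemigroupType}.
Hypothesis hS : hausdorff_space S.

Lemma cvg_mulg I (F : set_system I) (u v : I -> S) (p q : S) : Filter F ->
  u @ F --> p -> v @ F --> q -> (fun i => u i * v i) @ F --> p * q.
Proof.
move=> FF up vq; apply: (@cvg_comp _ _ _ (fun i => (u i, v i))
  (fun x : S * S => x.1 * x.2)); last first.
  exact: (@mulg_continuous S (p, q)).
exact: cvg_pair.
Qed.


Lemma continuous_mulgr (a : S) : continuous (fun x : S => x * a).
Proof. by move=> x; apply: cvg_mulg; [exact: cvg_id|exact: cvg_cst]. Qed.

Lemma continuous_power n : continuous (fun x : S => power x n).
Proof.
elim: n => [|n IH] x; first exact: cvg_id.
by apply: cvg_mulg; [exact: cvg_id|exact: IH].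
Qed.

Variable inv : S -> S.
Hypothesis invP : inversion inv.
Hypothesis ccS : countably_compact [set: S].
Hypothesis base_idem : forall e : S, e * e = e -> countable_base_at e.

Lemma accumulation_filter (u : nat -> S) : exists (p : S) (F : set_system nat),
  [/\ ProperFilter F, F --> \oo & u @ F --> p].
Proof.
have [p up] := countably_compact_clusters ccS u.
by have [F hF] := clusters_along up; exists p, F.
Qed.

(** Put g = unit_of z. Then z' x^m accumulates at g, which has a countable
    base, so that u k = z' x^(m k) tends to g for some fast growing m.
    Then u (k+1) = u k * x^(m (k+1) - m k), and any accumulation point w
    of the last factor satisfies g = g w. *)
Lemma absorbed_power_limit (x z : S) : clusters_at (power x) z ->
  exists w, clusters_at (power x) w /\ unit_of inv z * w = unit_of inv z.
Proof.
move=> xz; have [F [PF Foo Fz]] := clusters_along xz.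
have gg := unit_of_idem invP z.
pose u n := inv z * power x n.
have ug : clusters_at u (unit_of inv z).
  apply: (along_clusters PF Foo).
  rewrite /unit_of invC //; apply: cvg_mulg => //; exact: cvg_cst.
have [O [Og OU]] := base_idem gg.
have /choice[nxt hnxt] (km : nat * nat) : exists n,
    (km.2 + km.1 < n)%N /\ O km.1 (u n).
  have [|n] := ug (km.2 + km.1).+1 (O km.1); last by exists n.
  by apply: open_nbhs_nbhs; exact: Og.
pose m := fix m k := if k is k.+1 then nxt (k.+1, m k) else nxt (0%N, 0%N).
have mO k : O k (u (m k)).
  by case: k => [|k]; [exact: (hnxt (0, 0)%N).2|exact: (hnxt (k.+1, m k)).2].
have mlt k : (m k + k.+1 < m k.+1)%N by exact: (hnxt (k.+1, m k)).1.
have um : (u \o m) @ \oo --> unit_of inv z by exact: countable_base_cvg OU mO.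
(* One is subtracted because [power x n] has exponent n + 1. *)
pose gap k := (m k.+1 - (m k).+1)%N.
have gapk k : (k <= gap k)%N.
  rewrite /gap leq_subRL; first by rewrite addSn -addnS; exact: ltnW.
  by apply: leq_trans (mlt k); rewrite ltnS leq_addr.
have gapE k : m k.+1 = (m k + gap k).+1.
  rewrite /gap -addSn subnKC //.
  by apply: leq_trans (mlt k); rewrite ltnS leq_addr.
have [w [G [PG Goo Gw]]] := accumulation_filter (power x \o gap).
exists w; split; first exact: clusters_sub gapk (along_clusters PG Goo Gw).
apply: (@lim_eq S hS _ G (fun k => u (m k) * power x (gap k))
  (fun k => u (m k.+1))).
- apply: cvg_mulg => //; apply: cvg_trans um; exact: cvg_app.
- have um1 := cvg_sub (fun k => leqnSn k) um.
  by apply: cvg_trans um1; exact: cvg_app.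
- by apply: nearW => k; rewrite gapE /u powerD mulgA.
Qed.

(** Iterating [absorbed_power_limit] yields accumulation points w n of the
    powers of x whose units h n increase, with h n * w m = h n for n < m.
    At a joint limit (a, b) of the pairs (h n, w n), the relations a b = a
    and b a = b make b idempotent; a is a limit along a subsequence
    because it is idempotent and so has a countable base, which lets b be
    an accumulation point of the corresponding w. *)
Lemma idempotent_power_limit (x : S) :
  exists h, clusters_at (power x) h /\ h * h = h.
Proof.
have [z0 xz0] := countably_compact_clusters ccS (power x).
have /choice[nxt hnxt] (z : S) : exists w, clusters_at (power x) z ->
    clusters_at (power x) w /\ unit_of inv z * w = unit_of inv z.
  have [xz|no] := pselect (clusters_at (power x) z); last by exists z.
  by have [w hw] := absorbed_power_limit xz; exists w.
pose w n := iter n nxt z0.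
have xw n : clusters_at (power x) (w n).
  by elim: n => //= n IH; exact: (hnxt _ IH).1.
pose h n := unit_of inv (w n).
have hw1 n : h n * w n.+1 = h n by exact: (hnxt _ (xw n)).2.
have hh1 n : h n * h n.+1 = h n.
  by rewrite -{1}(hw1 n) -mulgA mul_unit_of // hw1.
have hh n k : h n * h (n + k)%N = h n.
  elim: k => [|k IH]; first by rewrite addn0 unit_of_idem.
  by rewrite addnS -{1}IH -mulgA hh1 IH.
have hw n m : (n < m)%N -> h n * w m = h n.
  move=> nm; rewrite -(subnKC nm) addSn -[in LHS](hh n (m - n.+1)%N) -mulgA hw1.
  exact: hh.
have [a ha] := countably_compact_clusters ccS h.
have aa : a * a = a.
  have [F [PF Foo Fa]] := clusters_along ha.
  apply: (@lim_eq S hS _ F (fun k => h k * h k) h) => //; first exact: cvg_mulg.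
  by apply: nearW => k; exact: unit_of_idem.
have [phi [phik hphi]] := clusters_subsequence (base_idem aa) ha.
have [b [G [PG Goo Gb]]] := accumulation_filter (w \o phi).
have hphiG : (h \o phi) @ G --> a by apply: cvg_trans hphi; exact: cvg_app.
have wb : clusters_at w b.
  exact: clusters_sub phik (along_clusters PG Goo Gb).
have hb n : h n * b = h n.
  apply: (@lim_eq S hS _ G (fun k => h n * w (phi k)) (fun=> h n)).
  - apply: cvg_mulg => //; exact: cvg_cst.
  - exact: cvg_cst.
  - apply: Goo; exists n.+1 => // k nk; apply: hw; exact: leq_trans (phik k).
have ab : a * b = a.
  apply: (@lim_eq S hS _ G (fun k => h (phi k) * b) (h \o phi)) => //.
  - apply: cvg_mulg => //; exact: cvg_cst.
  - by apply: nearW => k; exact: hb.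
have ba : b * a = b.
  apply: (@lim_eq S hS _ G (fun k => w (phi k) * h (phi k)) (w \o phi)) => //.
  - exact: cvg_mulg.
  - by apply: nearW => k; exact: mul_unit_of.
exists b; split; last by rewrite -{1}ba -mulgA ab ba.
have := @closed_clusters _ (power x); apply => U /(wb 0%N)[n _ Un].
by exists (w n).
Qed.

(** An idempotent limit h of x^(m k) is unit_of x: for an accumulation
    point t of the inverse powers h t = unit_of x, hence h unit_of x = h h
    t = unit_of x, whereas h unit_of x = h because unit_of x fixes the
    powers of x. *)
Lemma unit_of_power_limit (x : S) : clusters_at (power x) (unit_of inv x).
Proof.
have [h [xh hh]] := idempotent_power_limit x.
suff <- : h = unit_of inv x by [].
have [phi [_ hphi]] := clusters_subsequence (base_idem hh) xh.
have [t [G [PG Goo Gt]]] := accumulation_filter (power (inv x) \o phi).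
have hphiG : (power x \o phi) @ G --> h by apply: cvg_trans hphi; exact: cvg_app.
have ht : h * t = unit_of inv x.
  apply: (@lim_eq S hS _ G (fun k => power x (phi k) * power (inv x) (phi k))
    (fun=> unit_of inv x)); [exact: cvg_mulg|exact: cvg_cst|].
  by apply: nearW => k; exact: power_inv.
have he : h * unit_of inv x = h.
  apply: (@lim_eq S hS _ G (fun k => power x (phi k) * unit_of inv x)
    (power x \o phi)) => //.
  - apply: cvg_mulg => //; exact: cvg_cst.
  - by apply: nearW => k; exact: power_unit_of.
by rewrite -{1}he -ht mulgA hh.
Qed.

(** The equation y x' = unit_of x alone also holds for some y in groups above
    that of x. Asking that some power of y be in each member O k of a base at
    unit_of x pins down the group of y. *)
Lemma Gdelta_point (x : S) :
  (forall e : S, e * e = e -> Gdelta [set e]) -> Gdelta [set x].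
Proof.
move=> Ge; set e := unit_of inv x.
have ee : e * e = e by exact: unit_of_idem.
have [O [Oe OU]] := base_idem ee.
pose W k := \bigcup_m (fun y => power y m) @^-1` O k.
have oW k : open (W k).
  apply: bigcup_open => m _; have /continuousP := @continuous_power m; apply.
  by case: (Oe k).
suff -> : [set x] = (fun y => y * inv x) @^-1` [set e] `&` \bigcap_k W k.
  apply: GdeltaI; last by exists W.
  by apply: Gdelta_preimage; [exact: continuous_mulgr|exact: Ge].
apply/seteqP; split=> [_ ->|y [/= yx Wy]].
  split=> // k _; have [|m _ Om] := @unit_of_power_limit x 0%N (O k).
    by apply: open_nbhs_nbhs; exact: Oe.
  by exists m.
have /choice[m hm] k : exists m, O k (power y m).
  by have [m _ Om] := Wy k I; exists m.
have ye : (fun k => power y (m k)) @ \oo --> e by exact: countable_base_cvg OU hm.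
have [t [G [PG Goo Gt]]] := accumulation_filter (power (inv y) \o m).
have yeG : (fun k => power y (m k)) @ G --> e.
  by apply: cvg_trans ye; exact: cvg_app.
have et : e * t = unit_of inv y.
  apply: (@lim_eq S hS _ G (fun k => power y (m k) * power (inv y) (m k))
    (fun=> unit_of inv y)); [exact: cvg_mulg|exact: cvg_cst|].
  by apply: nearW => k; exact: power_inv.
have ef : e * unit_of inv y = e.
  apply: (@lim_eq S hS _ G (fun k => power y (m k) * unit_of inv y)
    (fun k => power y (m k))) => //.
  - apply: cvg_mulg => //; exact: cvg_cst.
  - by apply: nearW => k; exact: power_unit_of.
have fe : unit_of inv y = e by rewrite -ef -et mulgA ee.
rewrite -(mul_unit_of invP y) fe /e /unit_of invC // mulgA yx.
exact: invKm.
Qed.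

End CliffordTopology.

(** * Continuity of the inversion *)

Section InversionContinuity.
Local Open Scope group_scope.
Context {S : topologicalSemigroupType}.
Hypothesis hS : hausdorff_space S.
Hypothesis ccS : countably_compact [set: S].
Hypothesis base : forall x : S, countable_base_at x.
Variable inv : S -> S.
Hypothesis invP : inversion inv.

(** The inversion has a closed graph by [commuting_inverse_unique]: if u
    tends to x, all accumulation points of the inverses of u are inverse
    to x. *)
Lemma inversion_continuous : continuous inv.
Proof.
move=> x U xU; apply: contrapT => nU.
have [O [Ox OU]] := base x.
have /choice[u hu] k : exists y, O k y /\ ~ U (inv y).
  apply: contrapT => /forallNP no; apply: nU.
  have : nbhs x (O k) by apply: open_nbhs_nbhs; exact: Ox.
  apply: filterS => y Oy; apply: contrapT => nUy; exact: (no y).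
have ux : u @ \oo --> x.
  by apply: countable_base_cvg OU _ => k; exact: (hu k).1.
have [z [G [PG Goo Gz]]] := accumulation_filter ccS (inv \o u).
have uxG : u @ G --> x by apply: cvg_trans ux; exact: cvg_app.
have eqn (f g : S -> S -> S) (p q : S) :
    (fun k => f (u k) (inv (u k))) @ G --> p ->
    (fun k => g (u k) (inv (u k))) @ G --> q ->
    (forall y, f y (inv y) = g y (inv y)) -> p = q.
  move=> fp gq fg; apply: (lim_eq hS PG fp gq); apply: nearW => k; exact: fg.
have zx : inv x = z.
  apply: (@commuting_inverse_unique _ x);
    [exact: invKm|exact: invmK|exact: invC| | |].
  - apply: (eqn (fun y z => y * z * y) (fun y _ => y)) => //.
      by do 2!apply: cvg_mulg => //.
    exact: invKm.
  - apply: (eqn (fun y z => z * y * z) (fun _ z => z)) => //.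
      by do 2!apply: cvg_mulg => //.
    exact: invmK.
  - by apply: (eqn *%g (fun y z => z * y));
      [exact: cvg_mulg|exact: cvg_mulg|exact: invC].
have GU : G (fun k => U (inv (u k))) by apply: Gz; rewrite -zx.
by have [k] := filter_ex GU; exact: (hu k).2.
Qed.

End InversionContinuity.

(** * Distances inducing a given topology *)

Section Metrizes.
Local Open Scope ring_scope.
Context {R : realType}.

(** The distance is a mere function on the given topological space, which
    avoids handling a second topology on the same carrier. *)
Definition metrizes {T : topologicalType} (d : T -> T -> R) :=
  [/\ forall x, d x x = 0, forall x y, d x y = 0 -> x = y,
      forall x y, d x y = d y x, forall y x z, d x z <= d x y + d y z &
      forall x A, nbhs x A <-> exists2 r, 0 < r & [set y | d x y < r] `<=` A].

Section Carrier.
Context {T : topologicalType} {d : T -> T -> R} (dP : metrizes d).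

(** A copy of T whose topology is the one defined by d. *)
Definition metric_carrier : Type := let _ := dP in T.

Let distxx (x : metric_carrier) : d x x = 0. Proof. by case: dP. Qed.
Let dist0 (x y : metric_carrier) : d x y = 0 -> x = y.
Proof. by case: dP => _ + _ _ _; apply. Qed.
Let distC (x y : metric_carrier) : d x y = d y x. Proof. by case: dP. Qed.
Let distD (y x z : metric_carrier) : d x z <= d x y + d y z.
Proof. by case: dP. Qed.

HB.instance Definition _ := Choice.on metric_carrier.
HB.instance Definition _ :=
  isMetric.Build R metric_carrier distxx dist0 distC distD.

Lemma open_metric_carrier (A : set T) :
  @open metric_carrier A <-> @open T A.
Proof.
have nE (x : T) : @nbhs _ metric_carrier x A <-> @nbhs _ T x A.
  have [_ _ _ _ ->] := dP.
  rewrite -(@nbhs_ballE _ metric_carrier).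
  by split=> -[r r0 rA]; exists r.
rewrite !openE; split=> oA x Ax; apply/nE; exact: oA.
Qed.

End Carrier.

Lemma metrizableP (T : topologicalType) :
  metrizable R T <-> exists d : T -> T -> R, metrizes d.
Proof.
split=> [[m mT]|[d dP]]; last first.
  exists (Metric.class (metric_carrier dP)) => /= A.
  exact: (open_metric_carrier dP).
pose M : metricType R := Metric.Pack m.
exists (@mdist R M); split.
- exact: (@mdistxx _ M).
- exact: (@mdist_positivity _ M).
- exact: (@metric_sym _ M).
- by move=> y x z; exact: (@metric_triangle _ M).
- move=> x A; have -> : @nbhs _ T x A <-> @nbhs _ M x A.
    rewrite [@nbhs _ T x]nbhsE [@nbhs _ M x]nbhsE.
    by split=> -[U [oU Ux] UA]; exists U => //; split=> //; apply/mT.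
  rewrite -(@nbhs_ballE _ M).
  have bE r : @ball _ M x r = [set y | mdist (x : M) y < r].
    exact: ballEmdist.
  by split=> -[r r0 rA]; exists r => // y xy; apply: rA; move: xy; rewrite bE.
Qed.

(** The pseudometric of a countably based uniformity is only known through
    its balls; its distance is the infimum of the radii, finite since all
    points are within a ball of radius 2. *)
Lemma countable_uniformity_metrizable (U : uniformType) :
  hausdorff_space U -> countable_uniformity U -> metrizable R U.
Proof.
move=> hU cU; apply/metrizableP.
pose V : pseudoMetricType R := countable_uniform cU.
have fin (x y : V) : edist (x, y) \is a fin_num.
  apply/edist_finP; exists 2 => //.
  exact: countable_uniform.countable_uniform_bounded.
pose d (x y : V) : R := fine (edist (x, y)).
exists d; split.
- by move=> x; rewrite /d edist_refl.
- move=> x y xy0; apply: (close_eq hU).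
  have : @close V x y.
    by apply/edist_closeP; rewrite -[LHS]fineK // -/(d x y) xy0.
  exact.
- by move=> x y; rewrite /d edist_sym.
- by move=> y x z; rewrite /d -fineD // fine_le ?fin_numD ?fin // edist_triangle.
- move=> x A; have -> : @nbhs _ U x A <-> @nbhs _ V x A by [].
  rewrite -(@nbhs_ballE _ V); split=> -[r r0 rA].
    exists r => // y /=; rewrite -lte_fin fineK // => xy; apply: rA.
    exact: (@edist_lt_ball _ V _ (x, y)).
  exists (r / 2) => /=; first by rewrite divr_gt0.
  move=> y xy; apply: rA => /=.
  have : (@edist _ V (x, y) <= (r / 2)%:E)%E.
    by apply: edist_fin => //; rewrite divr_gt0.
  rewrite -[leLHS]fineK // lee_fin => /le_lt_trans; apply.
  by rewrite ltr_pdivrMr // ltr_pMr // ltr1n.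
Qed.

End Metrizes.

(** * Regular G-delta diagonals *)

Lemma cvg_prod_components (T U : topologicalType) I (F : set_system I)
    (u : I -> T * U) (p : T * U) : Filter F ->
  u @ F --> p -> (fst \o u) @ F --> p.1 /\ (snd \o u) @ F --> p.2.
Proof.
case: p => p q FF up; split; first exact: cvg_comp up cvg_fst.
exact: cvg_comp up cvg_snd.
Qed.

Section RegularDiagonal.
Context {R : realType} {T : topologicalType}.
Local Open Scope relation_scope.

Definition regular_Gdelta_diagonal := exists D : nat -> set (T * T),
  (forall n (x : T), nbhs (x, x) (D n)) /\
  forall p : T * T, (forall n, closure (D n) p) -> p.1 = p.2.

Hypothesis cT : sequentially_compact T.

Section Base.
Variable B : nat -> set (T * T).
Hypotheses (nB : forall n (x : T), nbhs (x, x) (B n))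
  (decB : forall n m, (n <= m)%N -> B m `<=` B n)
  (clB : forall p : T * T, (forall n, closure (B n) p) -> p.1 = p.2).

(** This is the source of the axioms of a uniformity: if all B m fail to
    be small enough for one of them, the counterexamples have a
    subsequence converging to a point of the diagonal, which contradicts
    their choice. *)
Lemma lim_diagonal (u : nat -> T * T) (phi : nat -> nat) (p : T * T) :
  (forall k, B k (u k)) -> (forall k, (k <= phi k)%N) ->
  (u \o phi) @ \oo --> p -> p.1 = p.2.
Proof.
move=> Bu phik up; apply: clB => n V /up[N _ NV].
exists (u (phi (maxn N n))); split; last by apply: NV; exact: leq_maxl.
by apply: decB (Bu _); apply: leq_trans (phik _); exact: leq_maxr.
Qed.

Lemma diagonal_hausdorff : hausdorff_space T.
Proof.
move=> p q pq; apply: (clB (p := (p, q))) => n W [[U V] [/= pU qV] UV].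
have [x [Ux Vx]] := pq U V pU qV; exists (x, x); split; last exact: UV.
exact: nbhs_singleton.
Qed.

Let ent : set_system (T * T) := filter_from setT B.

Let ent_filter : Filter ent.
Proof.
apply: filter_from_filter; first by exists 0%N.
move=> n m _ _; exists (maxn n m) => // p Bp.
by split; apply: decB Bp; [exact: leq_maxl|exact: leq_maxr].
Qed.

Let ent_diagonal A : ent A -> diagonal `<=` A.
Proof.
by move=> [n _ BA] [x y] /diagonalP ->; apply: BA; exact: nbhs_singleton.
Qed.

Let ent_inv A : ent A -> ent A^-1.
Proof.
move=> [n _ BA]; apply: contrapT => noA.
have /choice[u hu] m : exists p, B m p /\ ~ A (p.2, p.1).
  apply: contrapT => /forallNP no; apply: noA; exists m => // p Bp.
  apply: contrapT => nAp; exact: (no p).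
have [phi [p [phik up]]] := sequentially_compact_prod cT cT u.
have p12 : p.1 = p.2 by apply: lim_diagonal up => // k; exact: (hu k).1.
have : (fun k => ((u (phi k)).2, (u (phi k)).1)) @ \oo --> (p.2, p.1).
  apply: (@cvg_comp _ _ _ (u \o phi) (fun q => (q.2, q.1)) _ _ _ up).
  by apply: cvg_pair; [exact: cvg_snd|exact: cvg_fst].
rewrite -p12 => /(_ _ (nB n p.1))[N _ NB].
by have /BA := NB N (leqnn N); exact: (hu _).2.
Qed.

Let ent_split A : ent A -> exists2 C, ent C & C \; C `<=` A.
Proof.
move=> [n _ BA]; apply: contrapT => noA.
have /choice[u hu] m : exists p : T * T * T,
    [/\ B m p.1, B m (p.1.2, p.2) & ~ A (p.1.1, p.2)].
  apply: contrapT => /forallNP no; apply: noA; exists (B m); first by exists m.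
  move=> [x z] [y /= xy yz]; apply: contrapT => nxz.
  by apply: (no (x, y, z)).
have [phi [p [phik up]]] :=
  sequentially_compact_prod (sequentially_compact_prod cT cT) cT u.
have [up1 up2] := cvg_prod_components _ up.
have [up11 up12] := cvg_prod_components _ up1.
have p12 : p.1.1 = p.1.2.
  by apply: (@lim_diagonal (fst \o u) phi p.1) => // k; case: (hu k).
have p23 : p.1.2 = p.2.
  apply: (@lim_diagonal (fun k => ((u k).1.2, (u k).2)) phi (p.1.2, p.2)) => //.
    by move=> k; case: (hu k).
  exact: cvg_pair.
have : (fun k => ((u (phi k)).1.1, (u (phi k)).2)) @ \oo --> (p.1.1, p.2).
  exact: cvg_pair.
rewrite p12 p23 => /(_ _ (nB n p.2))[N _ NB].
by have /BA := NB N (leqnn N); case: (hu (phi N)).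
Qed.

Let ent_nbhs : nbhs = nbhs_ ent.
Proof.
apply/funext => x; apply/seteqP; split=> A.
  move=> xA; apply: contrapT => noA.
  have /choice[u hu] m : exists y, B m (x, y) /\ ~ A y.
    apply: contrapT => /forallNP no; apply: noA; exists (B m); first by exists m.
    move=> y /xsectionP xy; apply: contrapT => nAy; exact: (no y).
  have [phi [p [phik up]]] := cT u.
  have xp : x = p.
    apply: (@lim_diagonal (fun k => (x, u k)) phi (x, p)) => //.
      by move=> k; case: (hu k).
    by apply: cvg_pair => //; exact: cvg_cst.
  rewrite xp in xA; have [N _ NA] := up _ xA.
  by have := NA N (leqnn N); exact: (hu _).2.
move=> [C [n _ BC] CA]; apply: filterS CA _.
have xx : (fun y : T => (x, y)) @ nbhs x --> (x, x).
  by apply: cvg_pair; [exact: cvg_cst|exact: cvg_id].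
have xB : nbhs x [set y | B n (x, y)] := xx _ (nB n x).
by apply: filterS xB => y xy; apply: mem_set; exact: BC.
Qed.

(** A copy of T, on which the base B is recorded through the hypotheses it
    has to satisfy. *)
Definition diagonal_uniform : Type := let _ := nB in let _ := decB in T.

HB.instance Definition _ := Topological.on diagonal_uniform.
HB.instance Definition _ := Nbhs_isUniform_mixin.Build diagonal_uniform
  ent_filter ent_diagonal ent_inv ent_split ent_nbhs.

Lemma diagonal_metrizable : metrizable R T.
Proof.
apply: (@countable_uniformity_metrizable R diagonal_uniform).
  exact: diagonal_hausdorff.
apply/countable_uniformityP; exists B => [A [n _ BA]|n]; first by exists n.
by exists n.
Qed.

End Base.

Theorem regular_Gdelta_diagonal_metrizable :
  regular_Gdelta_diagonal -> metrizable R T.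
Proof.
move=> [D [nD clD]].
pose B := fix B n := if n is n.+1 then B n `&` D n.+1 else D 0%N.
have BD n : B n `<=` D n by case: n => [|n] // p [].
apply: (@diagonal_metrizable B) => [n x|n m|p clp].
- by elim: n => [|n IH] /=; [exact: nD|apply: filterI].
- elim: m => [|m IH]; first by rewrite leqn0 => /eqP ->.
  rewrite leq_eqVlt => /predU1P[->//|/IH]; apply: subset_trans.
  exact: subIsetl.
- by apply: clD => n; exact: closureS (BD n) _ (clp n).
Qed.

End RegularDiagonal.

(** * Metrizable subspaces *)

Section MetricAccumulation.
Local Open Scope ring_scope.
Context {R : realType} {T : topologicalType} (d : T -> T -> R).
Hypothesis dP : metrizes d.
Hypothesis accT : forall u : nat -> T, exists p, clusters_at u p.

Let B (x : T) (k : nat) : set T := [set y | d x y < k.+1%:R^-1].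

Lemma dist_nbhs x (r : R) : 0 < r -> nbhs x [set y | d x y < r].
Proof. by move=> r0; have [_ _ _ _ ->] := dP; exists r. Qed.

Lemma dist_halves (x y z : T) (k : nat) :
  d x y < k.+1.*2%:R^-1 -> d x z < k.+1.*2%:R^-1 -> d y z < k.+1%:R^-1.
Proof.
have [_ _ dC dD _] := dP; rewrite (dC x y) => xy xz.
apply: le_lt_trans (dD x y z) _.
have -> : k.+1%:R^-1 = k.+1.*2%:R^-1 + k.+1.*2%:R^-1 :> R.
  by rewrite -muln2 natrM invfM -splitr.
exact: ltrD.
Qed.

(** A principle of compactness for ideals of subsets, proved from
    sequences. Let rk x be the least k for which the ball B x k is in P.
    If setT is not in P, there is a sequence e with e n outside of all
    balls B (e i) (rk (e i)) for i < n, as finitely many of these cannot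
    cover. Near an accumulation point a of e the ranks stay bounded in
    terms of rk a, and two terms of e close to a are then too close to
    each other. *)
Lemma locally_to_globally (P : set T -> Prop) :
  P set0 -> (forall A C, P A -> P C -> P (A `|` C)) ->
  (forall A C, A `<=` C -> P C -> P A) ->
  (forall x : T, exists2 A, nbhs x A & P A) -> P setT.
Proof.
move=> P0 PU PS Ploc; apply: contrapT => nP.
have PB x : exists k, `[< P (B x k) >].
  have [A xA PA] := Ploc x; move: xA; have [_ _ _ _ ->] := dP => -[r r0 rA].
  have [k kr] : exists k, k.+1%:R^-1 < r.
    exists (Num.truncn r^-1); rewrite invf_plt ?posrE //.
    exact: truncnS_gt.
  exists k; apply/asboolP; apply: PS PA => y /= xy; apply: rA.
  exact: lt_trans kr.
pose rk x := ex_minn (PB x).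
have rkP x : P (B x (rk x)) by rewrite /rk; case: ex_minnP => m /asboolP.
have rk_min x k : P (B x k) -> (rk x <= k)%N.
  by move=> /asboolP Pk; rewrite /rk; case: ex_minnP => m _; apply.
have Pseq (l : seq T) : P [set y | exists2 x, x \in l & B x (rk x) y].
  elim: l => [|x l IH]; first by apply: PS P0 => y [].
  apply: PS (PU _ _ (rkP x) IH) => y [z].
  by rewrite inE => /predU1P[->|zl] zy; [left|right; exists z].
have /choice[f hf] (l : seq T) : exists y, forall x, x \in l -> ~ B x (rk x) y.
  apply: contrapT => /forallNP no; apply/nP/(PS _ _ _ (Pseq l)) => y _.
  have /existsNP[x /not_implyP[xl /contrapT xy]] := no y.
  by exists x.
pose l n := iter n (fun l => f l :: l) [::].
pose e n := f (l n).
have el i n : (i < n)%N -> e i \in l n.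
  elim: n => // n IH; rewrite ltnS leq_eqVlt /= inE => /predU1P[->|/IH ->].
    by rewrite eqxx.
  by rewrite orbT.
have [a ea] := accT e.
(* Balls of radius 1/(N+1) around points that close to a lie inside of
   B a (rk a), so N bounds the rank of these points. *)
pose N := (rk a).+1.*2.-1.
have NE : N.+1 = (rk a).+1.*2 by [].
have pos k : 0 < (k.+1.*2%:R : R)^-1 by rewrite invr_gt0 ltr0n.
have [i _ ai] := ea 0%N _ (dist_nbhs a (pos N)).
have [j ij aj] := ea i.+1 _ (dist_nbhs a (pos N)).
apply: (hf (l j) (e i) (el _ _ ij)).
have rki : (rk (e i) <= N)%N.
  apply: rk_min; apply: PS (rkP a) => y /= iy.
  have [_ _ dC dD _] := dP.
  apply: (@dist_halves (e i)); last by rewrite -NE.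
  rewrite dC (lt_trans ai) // ltf_pV2 ?posrE ?ltr0n // ltr_nat -NE.
  by rewrite -addnn -[X in (X < _)%N]addn0 ltn_add2l.
rewrite /B /=; apply: lt_le_trans (dist_halves ai aj) _.
by rewrite lef_pV2 ?posrE ?ltr0n // ler_nat.
Qed.

End MetricAccumulation.

Section Subspace.
Local Open Scope ring_scope.
Context {R : realType} {X : topologicalType} (A : set X).
Variable d : set_type A -> set_type A -> R.
Hypothesis dP : metrizes d.

Lemma nbhs_subtypeP (x : set_type A) U :
  nbhs x U <-> exists2 V, open_nbhs (\val x) V & \val @^-1` V `<=` U.
Proof.
split=> [[_ [[V oV <-] Vx VU]]|[V [oV Vx] VU]]; first by exists V.
by exists (\val @^-1` V); split=> //; exists V.
Qed.

Lemma subtype_clusters :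
  closed A -> (forall u : nat -> X, exists p, clusters_at u p) ->
  forall u : nat -> set_type A, exists p, clusters_at u p.
Proof.
move=> cA acc u; have [p up] := acc (\val \o u).
have Ap : A p.
  apply: cA => V /(up 0%N)[n _ Vn]; exists (\val (u n)); split=> //.
  exact: set_valP.
exists (SigSub (mem_set Ap)) => N U /nbhs_subtypeP[V /open_nbhs_nbhs /= pV VU].
by have [n Nn Vn] := up N V pV; exists n => //; exact: VU.
Qed.

(** The balls of radius 1/(n+1) around x in A are traces of open sets of
    X, and these cut x out of A. *)
Lemma metrizable_Gdelta_point (x : X) : Gdelta A -> A x -> Gdelta [set x].
Proof.
move=> GA Ax; pose a : set_type A := SigSub (mem_set Ax).
have /choice[W hW] n : exists V, open_nbhs x V /\
    \val @^-1` V `<=` [set y | d a y < n.+1%:R^-1].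
  have : nbhs a [set y | d a y < n.+1%:R^-1].
    by apply: dist_nbhs; rewrite ?invr_gt0.
  by move=> /nbhs_subtypeP[V xV VU]; exists V.
suff -> : [set x] = A `&` \bigcap_n W n.
  by apply: GdeltaI => //; exists W => // n; case: (hW n) => -[].
apply/seteqP; split=> [_ ->|y [Ay Wy]].
  by split=> // n _; case: (hW n) => -[].
pose b : set_type A := SigSub (mem_set Ay).
have [dxx d0 _ _ dN] := dP.
suff /d0/(congr1 \val) : d a b = 0 by [].
apply/eqP; apply/negPn/negP => ab0.
have dge0 : 0 <= d a b.
  have [_ _ dC dD _] := dP; have := dD b a a; rewrite dxx (dC b a); lra.
have ab : 0 < d a b by rewrite lt_neqAle eq_sym ab0.
have := (hW (Num.truncn (d a b)^-1)).2 b (Wy _ I).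
rewrite /= ltNge => /negP; apply; apply: ltW.
by rewrite invf_plt ?posrE // truncnS_gt.
Qed.

Lemma metrizable_shrinkable : regular_space X -> closed A ->
  (forall u : nat -> X, exists p, clusters_at u p) -> shrinkable A.
Proof.
move=> rX cA acc U oU AU.
pose P (G : set (set_type A)) := exists V,
  [/\ open V, \val @` G `<=` V & closure V `<=` U].
suff [V [oV AV VU]] : P setT.
  by exists V; split=> // x Ax; apply: AV; exists (SigSub (mem_set Ax)).
apply: (locally_to_globally dP (subtype_clusters cA acc)).
- exists set0; split; first exact: open0.
    by move=> _ [y []].
  by rewrite closure0.
- move=> G H [V [oV GV VU]] [W [oW HW WU]]; exists (V `|` W); split.
  + exact: openU.
  + by move=> _ [y [Gy|Hy] <-]; [left; apply: GV|right; apply: HW]; exists y.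
  + by rewrite closureU subUset.
- move=> G H GH [V [oV HV VU]]; exists V; split=> //.
  by move=> _ [y Gy <-]; apply: HV; exists y => //; exact: GH.
- move=> x; have Ux : nbhs (\val x) U.
    by apply: open_nbhs_nbhs; split=> //; apply: AU; exact: set_valP.
  have [W xW WU] := rX _ _ Ux.
  exists (\val @^-1` W°).
    apply/nbhs_subtypeP; exists W° => //.
    by split; [exact: open_interior|exact: xW].
  exists W°; split; first exact: open_interior.
    by move=> _ [y Wy <-].
  by apply: subset_trans WU; apply: closureS; exact: interior_subset.
Qed.

End Subspace.

Section DistanceOfMaps.
Local Open Scope ring_scope.
Context {R : realType} {X T : topologicalType} (d : T -> T -> R).
Hypothesis dP : metrizes d.

Lemma cvg_dist_lt (f : X -> T) x (r : R) : {for x, continuous f} -> 0 < r ->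
  nbhs x [set y | d (f x) (f y) < r].
Proof. by move=> cf r0; exact: (cf _ (dist_nbhs dP (f x) r0)). Qed.

Variables f g : X -> T.
Hypotheses (cf : continuous f) (cg : continuous g).

Lemma open_dist_lt (r : R) : open [set x | d (f x) (g x) < r].
Proof.
have [_ _ dC dD _] := dP.
rewrite openE => x /= xr; pose s := (r - d (f x) (g x)) / 2.
have s0 : 0 < s by rewrite /s; lra.
apply: filterS (filterI (cvg_dist_lt (@cf x) s0) (cvg_dist_lt (@cg x) s0)).
move=> y [/= fy gy].
have := dD (f x) (f y) (g y); have := dD (g x) (f x) (g y).
by rewrite (dC (f y) (f x)); move: fy gy; rewrite /s; lra.
Qed.

(** By continuity d (f x) (g x) <= 1/(n+1) for x in the n-th closure. *)
Lemma closure_dist_lt x :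
  (forall n, closure [set y | d (f y) (g y) < n.+1%:R^-1] x) -> f x = g x.
Proof.
have [dxx d0 dC dD _] := dP => clx; apply: d0.
have dge0 : 0 <= d (f x) (g x).
  by have := dD (g x) (f x) (f x); rewrite dxx (dC (g x)); lra.
apply/eqP; rewrite eq_le dge0 andbT leNgt; apply/negP => xy0.
pose s := d (f x) (g x) / 3; have s0 : 0 < s by rewrite /s; lra.
pose n := Num.truncn s^-1.
have ns : n.+1%:R^-1 < s by rewrite invf_plt ?posrE // truncnS_gt.
have [y [/= yn [/= fy gy]]] := clx n _
  (filterI (cvg_dist_lt (@cf x) s0) (cvg_dist_lt (@cg x) s0)).
have := dD (f y) (f x) (g x); have := dD (g y) (f y) (g x).
by rewrite (dC (g y) (g x)); move: (lt_trans yn ns) fy gy xy0; rewrite /s; lra.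
Qed.

End DistanceOfMaps.

Lemma metrizable_subspace (R : realType) (X : topologicalType) (A : set X) :
  metrizable R X -> metrizable R (set_type A).
Proof.
move=> /metrizableP[d dP]; apply/metrizableP.
have [dxx d0 dC dD dN] := dP.
exists (fun x y => d (\val x) (\val y)); split=> //.
- by move=> x y /d0; exact: val_inj.
- move=> x U; split=> [/nbhs_subtypeP[V /open_nbhs_nbhs /dN[r r0 rV] VU]|].
    by exists r => // y /= xy; apply/VU/rV.
  move=> [r r0 rU]; apply/nbhs_subtypeP.
  exists [set y | d (\val x) y < r]%R => //; split.
    by apply: (open_dist_lt dP); [exact: cst_continuous|move=> y; exact: cvg_id].
  by rewrite /= dxx.
Qed.

(** * The metrization criterion *)

Section Diagonal.
Local Open Scope group_scope.
Context {R : realType} {S : topologicalSemigroupType}.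

Lemma closed_idempotents : hausdorff_space S -> closed (idempotents S).
Proof.
move=> hS x clx.
suff : cluster (nbhs (x * x)) x by exact: hS.
move=> U V xU xV.
have UV : nbhs x ((fun z => z * z) @^-1` U `&` V).
  apply: filterI => //.
  have : (fun z : S => z * z) @ nbhs x --> x * x.
    by apply: cvg_mulg; exact: cvg_id.
  exact.
by have [e [ee [Ue Ve]]] := clx _ UV; exists e; split=> //; rewrite -ee.
Qed.

(** A pair (x, y) is on the diagonal as soon as x y' is in E and the units
    of x and y coincide; closed neighbourhoods of E in S and of the
    diagonal in E x E are pulled back along these two continuous maps. *)
Lemma metrizable_of_idempotents (inv : S -> S) (d : set_type (idempotents S) ->
    set_type (idempotents S) -> R) :
  accessible_space S -> regular_space S -> countably_compact [set: S] ->
  inversion inv -> metrizes d -> Gdelta (idempotents S) -> metrizable R S.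
Proof.
move=> aS rS cS invP dP GE.
have hS := regular_hausdorff aS rS.
have cE := closed_idempotents hS.
have Gidem (e : S) : e * e = e -> Gdelta [set e].
  by move=> ee; exact: (metrizable_Gdelta_point dP).
have base (x : S) : countable_base_at x.
  apply: Gdelta_countable_base => //.
  apply: (Gdelta_point hS invP) => // e /Gidem.
  exact: Gdelta_countable_base.
have cinv := inversion_continuous hS cS base invP.
have acc := countably_compact_clusters cS.
apply: regular_Gdelta_diagonal_metrizable.
  move=> u; have [p up] := acc u.
  have [phi [phik hphi]] := clusters_subsequence (base p) up.
  by exists phi, p.
have [V [oV EV _ clV]] :=
  Gdelta_shrink GE (metrizable_shrinkable dP rS cE acc).
pose pi (x : S) : set_type (idempotents S) :=
  SigSub (mem_set (unit_of_idem invP x : idempotents S _)).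
have cpi : continuous pi.
  move=> x U /nbhs_subtypeP[W /open_nbhs_nbhs /= xW WU].
  have cx : (fun z => z * inv z) @ nbhs x --> x * inv x.
    by apply: cvg_mulg; [exact: cvg_id|exact: cinv].
  by apply: filterS (cx _ xW : nbhs x _) => y Wy; exact: WU.
pose quo (p : S * S) := p.1 * inv p.2.
have cquo : continuous quo.
  move=> [x y]; apply: cvg_mulg; first exact: cvg_fst.
  by apply: cvg_comp; [exact: cvg_snd|exact: cinv].
have cpi1 : continuous (fun p : S * S => pi p.1).
  by move=> [x y]; apply: cvg_comp; [exact: cvg_fst|exact: cpi].
have cpi2 : continuous (fun p : S * S => pi p.2).
  by move=> [x y]; apply: cvg_comp; [exact: cvg_snd|exact: cpi].
exists (fun n =>
  quo @^-1` V n `&` [set p | d (pi p.1) (pi p.2) < n.+1%:R^-1]%R).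
split=> [n x|p clp].
  apply: open_nbhs_nbhs; split.
    apply: openI; first by move/continuousP: cquo; apply.
    exact: (open_dist_lt dP).
  split; first by apply: EV; exact: unit_of_idem.
  by have [dxx _ _ _ _] := dP; rewrite /= dxx invr_gt0.
apply: (eq_of_idempotent_quotient invP).
  have /(congr1 \val) : pi p.1 = pi p.2; last exact.
  apply: (closure_dist_lt dP cpi1 cpi2) => n.
  by apply: closureS (clp n); exact: subIsetr.
apply: (clV (quo p)) => n W /cquo /(clp n)[q [[Vq _] Wq]].
by exists (quo q).
Qed.

Lemma metrizable_Gdelta_idempotents :
  metrizable R S -> Gdelta (idempotents S).
Proof.
move=> /metrizableP[d dP].
have cid : continuous (@id S) by move=> x; exact: cvg_id.
have csq : continuous (fun x : S => x * x).
  by move=> x; apply: cvg_mulg; exact: cvg_id.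
exists (fun n => [set x : S | d (x * x)%g x < n.+1%:R^-1]%R).
  by move=> n; exact: (open_dist_lt dP csq cid).
have [dxx _ _ _ _] := dP.
apply/seteqP; split=> [x xx n _ /=|x xn].
  by rewrite xx dxx invr_gt0.
apply: (closure_dist_lt dP csq cid) => n; apply: subset_closure; exact: xn.
Qed.

End Diagonal.

Theorem theorem3p1 (R : realType) (S : topologicalSemigroupType)
    (S_T1 : accessible_space S) (S_regular : regular_space S)
    (S_countably_compact : countably_compact [set: S])
    (S_clifford : clifford S) :
  metrizable R S <->
  metrizable R (set_type (idempotents S)) /\ Gdelta (idempotents S).
Proof.
split=> [mS|[/metrizableP[d dP] GE]].
  by split; [exact: metrizable_subspace|exact: metrizable_Gdelta_idempotents mS].
have [inv invP] := clifford_inversion S_clifford.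
exact: (metrizable_of_idempotents S_T1 S_regular S_countably_compact invP dP).
Qed.
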